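(* Let $n\ge 2$, let $F=(F_1,\dots,F_n)$ and $G=(G_1,\dots,G_n)$ be smooth maps $\mathbb{R}^n\times\mathbb{R}^2\to\mathbb{R}^n$ of $(z,x,t)$, let $B:\mathbb{R}^n\times\mathbb{R}^2\to\mathbb{R}$ be smooth, and define the matrices $M(z,x,t)=(M_{\mu\nu})$ and $K(z,x,t)=(K_{\mu\nu})$ by $$M_{\mu\nu}=\frac{\partial F_\nu}{\partial z^\mu}-\frac{\partial F_\mu}{\partial z^\nu},\qquad K_{\mu\nu}=\frac{\partial G_\nu}{\partial z^\mu}-\frac{\partial G_\mu}{\partial z^\nu}.$$ Let $z=z(x,t)\in\mathbb{R}^n$ be a smooth solution, on an open set $\Omega\subset\mathbb{R}^2$, of the multi-symplectic Birkhoff equations $$\sum_{\nu}M_{\mu\nu}(z,x,t)\frac{\partial z^\nu}{\partial t}+\sum_\nu K_{\mu\nu}(z,x,t)\frac{\partial z^\nu}{\partial x}=\frac{\partial B}{\partial z^\mu}(z,x,t)+\frac{\partial F_\mu}{\partial t}(z,x,t)+\frac{\partial G_\mu}{\partial x}(z,x,t),\qquad \mu=1,\dots,n,$$ and let $U,V:\Omega\to\mathbb{R}^n$ be any two smooth solutions of the linearization of these equations about $z$ (the variational equations). Put $$\omega(U,V)(x,t)=\langle M(z(x,t),x,t)\,U(x,t),V(x,t)\rangle,\qquad \kappa(U,V)(x,t)=\langle K(z(x,t),x,t)\,U(x,t),V(x,t)\rangle .$$ Then, on $\Omega$, $$\frac{\partial}{\partial t}\,\omega(U,V)+\frac{\partial}{\partial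 x}\,\kappa(U,V)=0 .$$
   Context: Here $\langle\cdot,\cdot\rangle$ is the standard inner product on $\mathbb{R}^n$. In the Birkhoff equations, $\partial F_\mu/\partial t$ and $\partial G_\mu/\partial x$ denote partial derivatives with respect to the explicit variables $t$ and $x$ (with $z$ held fixed), evaluated at $(z(x,t),x,t)$. In the conclusion, $\omega(U,V)$ and $\kappa(U,V)$ are functions of $(x,t)\in\Omega$, and $\partial/\partial t$, $\partial/\partial x$ are the derivatives of these functions (so they also differentiate through $z(x,t)$, $U(x,t)$, $V(x,t)$). The linearization of the Birkhoff equations about $z$ is the following linear system for $U:\Omega\to\mathbb{R}^n$: for $\mu=1,\dots,n$, $$\sum_\nu\Big(M_{\mu\nu}\frac{\partial U^\nu}{\partial t}+K_{\mu\nu}\frac{\partial U^\nu}{\partial x}\Big)+\sum_{\nu,\tau}\Big(\frac{\partial M_{\mu\nu}}{\partial z^\tau}\frac{\partial z^\nu}{\partial t}+\frac{\partial K_{\mu\nu}}{\partial z^\tau}\frac{\partial z^\nu}{\partial x}\Big)U^\tau=\sum_\tau\frac{\partial}{\partial z^\tau}\Big(\frac{\partial B}{\partial z^\mu}+\frac{\partial F_\mu}{\partial t}+\frac{\partial G_\mu}{\partial x}\Big)U^\tau,$$ where all coefficient functions are evaluated at $(z(x,t),x,t)$. *)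

(* Defs.v *)
From HB Require Import structures.
From mathcomp Require Import all_boot all_order all_algebra.
From mathcomp Require Import all_classical all_reals all_analysis.

Set Implicit Arguments.
Unset Strict Implicit.
Unset Printing Implicit Defensive.

Import Order.TTheory GRing.Theory Num.Theory.
Import numFieldNormedType.Exports.

Local Open Scope classical_set_scope.
Local Open Scope ring_scope.

(* Points of R^n are column vectors 'cV[R]_n, points of the (x, t)-plane are
   pairs (x, t) : R * R, and functions of (z, x, t) have domain
   'cV[R]_n * (R * R). Functions on an open subset A of a space are total
   functions constrained only at the points of A; as A is open, their
   derivatives at the points of A do not depend on the values outside A. *)

(* f has class C^k on the open set A; on a finite-dimensional V the class C^k+1
   is differentiability together with all directional derivatives being C^k. *)
Fixpoint Ck (R : realType) (V W : normedModType R) (k : nat) (A : set V)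
    (f : V -> W) : Prop :=
  match k with
  | 0 => {in A, continuous f}
  | k'.+1 => (forall a, A a -> differentiable f a) /\
             (forall v, Ck k' A ('D_v f))
  end.

Definition smooth_on (R : realType) (V W : normedModType R) (A : set V)
    (f : V -> W) : Prop :=
  forall k, Ck k A f.

Section BirkhoffSystem.
Context {R : realType} {n : nat}.

Local Notation phase := ('cV[R]_n * (R * R))%type.

Definition component (T : Type) (f : T -> 'cV[R]_n) (mu : 'I_n) : T -> R :=
  fun a => f a mu 0.

(* Partial derivatives with respect to the explicit variables z^mu, x, t. *)
Definition pdz (mu : 'I_n) (f : phase -> R) : phase -> R :=
  'D_(delta_mx mu 0, (0, 0)) f.
Definition pdx (f : phase -> R) : phase -> R := 'D_(0, (1, 0)) f.
Definition pdt (f : phase -> R) : phase -> R := 'D_(0, (0, 1)) f.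

(* Derivatives of functions of (x, t) only. *)
Definition ddx (f : R * R -> R) : R * R -> R := 'D_(1, 0) f.
Definition ddt (f : R * R -> R) : R * R -> R := 'D_(0, 1) f.

(* M is birkhoff_mx F and K is birkhoff_mx G. *)
Definition birkhoff_mx (F : phase -> 'cV[R]_n) (y : phase) : 'M[R]_n :=
  \matrix_(mu, nu) (pdz mu (component F nu) y - pdz nu (component F mu) y).

Definition birkhoff_entry (F : phase -> 'cV[R]_n) (mu nu : 'I_n) : phase -> R :=
  fun y => birkhoff_mx F y mu nu.

Definition birkhoff_rhs (F G : phase -> 'cV[R]_n) (B : phase -> R)
    (mu : 'I_n) : phase -> R :=
  fun y => pdz mu B y + pdt (component F mu) y + pdx (component G mu) y.

Definition birkhoff_eqs (F G : phase -> 'cV[R]_n) (B : phase -> R)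
    (Omega : set (R * R)) (z : R * R -> 'cV[R]_n) : Prop :=
  forall p, Omega p -> forall mu : 'I_n,
    \sum_nu birkhoff_mx F (z p, p) mu nu * ddt (component z nu) p
    + \sum_nu birkhoff_mx G (z p, p) mu nu * ddx (component z nu) p
    = birkhoff_rhs F G B mu (z p, p).

Definition variational_eqs (F G : phase -> 'cV[R]_n) (B : phase -> R)
    (Omega : set (R * R)) (z U : R * R -> 'cV[R]_n) : Prop :=
  forall p, Omega p -> forall mu : 'I_n,
    \sum_nu (birkhoff_mx F (z p, p) mu nu * ddt (component U nu) p
             + birkhoff_mx G (z p, p) mu nu * ddx (component U nu) p)
    + \sum_nu \sum_tau
        (pdz tau (birkhoff_entry F mu nu) (z p, p) * ddt (component z nu) p
         + pdz tau (birkhoff_entry G mu nu) (z p, p) * ddx (component z nu) p)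
        * U p tau 0
    = \sum_tau pdz tau (birkhoff_rhs F G B mu) (z p, p) * U p tau 0.

Definition inner (u v : 'cV[R]_n) : R := \sum_mu u mu 0 * v mu 0.

(* omega(U, V) is pulled_form F z U V and kappa(U, V) is pulled_form G z U V. *)
Definition pulled_form (F : phase -> 'cV[R]_n) (z U V : R * R -> 'cV[R]_n) :
    R * R -> R :=
  fun p => inner (birkhoff_mx F (z p, p) *m U p) (V p).

End BirkhoffSystem.

(* Main.v *)
(* Writing the two-form as d of the one-form F makes M skew and closed. By the
   chain rule, the derivative of <M U, V> along e is then V paired with the
   F-part of the linearized equation for U, minus U paired with that part for V:
   the terms in dz/de cancel by closedness of M and the terms in the explicit
   derivative of M by symmetry of second derivatives. Adding the F-part along t
   and the G-part along x, the variational equations leave the Hessian of B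
   applied to (V, U) minus the same applied to (U, V), which is 0. *)
Require Import Defs.
From HB Require Import structures.
From mathcomp Require Import all_boot all_order all_algebra.
From mathcomp Require Import all_classical all_reals all_analysis.
From mathcomp Require Import ring.
Set Implicit Arguments.
Unset Strict Implicit.
Unset Printing Implicit Defensive.
Import Order.TTheory GRing.Theory Num.Theory.
Import numFieldNormedType.Exports.
Local Open Scope classical_set_scope.
Local Open Scope ring_scope.

(** * Mean values along lines and symmetry of second derivatives *)

Lemma is_derive_line (R : realType) (V W : normedModType R) (f : V -> W)
    (x v : V) (s : R) :
  derivable f (x + s *: v) v ->
  is_derive s 1 (fun r : R => f (x + r *: v)) ('D_v f (x + s *: v)).
Proof.
have E : (fun h : R => h^-1 *: (((fun r : R => f (x + r *: v)) \o shift s) (h *: 1)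
            - f (x + s *: v)))
       = (fun h => h^-1 *: ((f \o shift (x + s *: v)) (h *: v) - f (x + s *: v))).
  apply/funext => h /=; congr (_ *: (f _ - _)).
  by rewrite [h *: 1]mulr1 scalerDl addrCA.
move=> df; split; first by rewrite /derivable E.
by rewrite /derive E.
Qed.

Lemma is_derive_translate (R : realType) (V W : normedModType R) (f : V -> W)
    (x v w : V) :
  derivable f (x + w) v ->
  is_derive x v (fun y => f (y + w)) ('D_v f (x + w)).
Proof.
have E : (fun h : R => h^-1 *: (((fun y => f (y + w)) \o shift x) (h *: v)
            - f (x + w)))
       = (fun h => h^-1 *: ((f \o shift (x + w)) (h *: v) - f (x + w))).
  by apply/funext => h /=; rewrite addrA.
move=> df; split; first by rewrite /derivable E.
by rewrite /derive E.
Qed.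

Lemma MVT_line (R : realType) (V : normedModType R) (f : V -> R)
    (x v : V) (h : R) : 0 < h ->
  (forall s, 0 <= s <= h -> derivable f (x + s *: v) v) ->
  exists2 s, 0 <= s <= h & f (x + h *: v) - f x = h * 'D_v f (x + s *: v).
Proof.
move=> h0 df.
have [||s sI] := @MVT R (fun r => f (x + r *: v))
    (fun r => 'D_v f (x + r *: v)) 0 h h0.
- move=> s; rewrite in_itv/= => /andP[s0 sh].
  by apply: is_derive_line; apply: df; rewrite !ltW.
- apply: derivable_within_continuous => s; rewrite in_itv/= => sI.
  by have [] := is_derive_line (df _ sI).
rewrite scale0r addr0 subr0 mulrC => ->; exists s => //.
by move: sI; rewrite in_itv/= => /andP[? ?]; rewrite !ltW.
Qed.

(* Both orders of differentiation produce the same left-hand side, whence Schwarz's theorem. *)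
Lemma second_difference (R : realType) (V : normedModType R) (f : V -> R)
    (a v w : V) (h : R) : 0 < h ->
  (forall s t, 0 <= s <= h -> 0 <= t <= h ->
     derivable f (a + s *: v + t *: w) v /\
     derivable ('D_v f) (a + s *: v + t *: w) w) ->
  exists s t, [/\ 0 <= s <= h, 0 <= t <= h &
    f (a + h *: v + h *: w) - f (a + h *: w) - (f (a + h *: v) - f a)
    = h ^+ 2 * 'D_w ('D_v f) (a + s *: v + t *: w)].
Proof.
move=> h0 df.
have hh : 0 <= h <= h by rewrite lexx ltW.
have h00 : (0 : R) <= 0 <= h by rewrite lexx ltW.
(* The second difference is the increment along [v] of [f (y + h *: w) - f y]; a first mean value
   argument along [v] turns it into an increment of ['D_v f] along [w], to which a second one
   applies. *)
have sg s : 0 <= s <= h -> is_derive (a + s *: v) v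
    (fun y => f (y + h *: w) - f y)
    ('D_v f (a + s *: v + h *: w) - 'D_v f (a + s *: v)).
  move=> sI.
  have [d1 _] := df s h sI hh; have [] := df s 0 sI h00.
  rewrite scale0r addr0 => d0 _.
  apply: is_deriveB; last exact: derivableP.
  exact: is_derive_translate d1.
have [|s sI] := @MVT_line R V (fun y => f (y + h *: w) - f y) a v h h0.
  by move=> s /sg [].
have [_ ->] := sg _ sI => Es.
have [|t tI Et] := @MVT_line R V ('D_v f) (a + s *: v) w h h0.
  by move=> t tI; have [] := df s t sI tI.
exists s, t; split=> //.
by rewrite expr2 -mulrA -Et -Es opprB addrA; ring.
Qed.

Lemma near_parallelogram (R : realType) (V : normedModType R) (a v w : V)
    (P : V -> Prop) : (\forall y \near a, P y) ->
  exists2 h : R, 0 < h &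
    forall s t, 0 <= s <= h -> 0 <= t <= h -> P (a + s *: v + t *: w).
Proof.
move=> Pa.
have c : (a + p.1 *: v + p.2 *: w) @[p --> (0 : R, 0 : R)] --> a.
  rewrite -[X in _ --> X]addr0 -[X in _ --> X + _]addr0.
  rewrite -[X in _ --> _ + X + _](scale0r v) -[X in _ --> _ + X](scale0r w).
  by apply: cvgD; [apply: cvgD; [exact: cvg_cst|]|];
    apply: cvgZr_tmp; [exact: cvg_fst|exact: cvg_snd].
have /nbhs_ballP[e /= e0 eP] := c _ Pa.
(* Halving [e] keeps the closed square of side [h] inside the open ball of radius [e]. *)
exists (e / 2); first by rewrite divr_gt0.
move=> s t /andP[s0 sh] /andP[t0 th]; apply: (eP (s, t)).
have eh : e / 2 < e by rewrite ltr_pdivrMr// ltr_pMr// ltr1n.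
by split; rewrite /ball/= sub0r normrN ger0_norm//; apply: le_lt_trans eh.
Qed.

Lemma norm_sub_lt_mid (R : realFieldType) (x y z e : R) :
  `|y - x| < e / 2 -> `|z - x| < e / 2 -> `|y - z| < e.
Proof.
move=> yx zx; rewrite (le_lt_trans (ler_distD x _ _))// [e]splitr.
by rewrite ltrD// distrC.
Qed.

(** On a small parallelogram at [a] the second difference equals [h ^+ 2] times each mixed
    derivative, taken at two possibly different points. Continuity at [a] puts both values within
    [e / 2] of those at [a], for arbitrary [e]. *)
Lemma derive_symmetric (R : realType) (V : normedModType R) (A : set V)
    (f : V -> R) (a v w : V) : open A -> Ck 2 A f -> A a ->
  'D_w ('D_v f) a = 'D_v ('D_w f) a.
Proof.
move=> Ao [df d2f] Aa.
have nbA : \forall y \near a, A y by exact: open_nbhs_nbhs.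
apply/eqP; rewrite -subr_eq0 -normr_le0; apply/ler_addgt0Pl => e e0.
have [_ /(_ w) /= cvw] := d2f v; have [_ /(_ v) /= cwv] := d2f w.
have {}cvw := cvw a (mem_set Aa); have {}cwv := cwv a (mem_set Aa).
have e2 : 0 < e / 2 by rewrite divr_gt0.
move/cvgrPdist_lt : cvw => /(_ _ e2) n1.
move/cvgrPdist_lt : cwv => /(_ _ e2) n2.
have [h h0 Ph] := near_parallelogram v w (filterI nbA (filterI n1 n2)).
have [s [t [sI tI E1]]] : exists s t, [/\ 0 <= s <= h, 0 <= t <= h &
    f (a + h *: v + h *: w) - f (a + h *: w) - (f (a + h *: v) - f a)
    = h ^+ 2 * 'D_w ('D_v f) (a + s *: v + t *: w)].
  apply: second_difference => // s t sI tI; have [Ay _] := Ph s t sI tI.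
  by split; apply: diff_derivable; [exact: df|have [+ _] := d2f v; exact].
(* Same parallelogram with [v] and [w] exchanged, so the parameters enter [Ph] in the opposite
   order. *)
have [s' [t' [sI' tI' E2]]] : exists s t, [/\ 0 <= s <= h, 0 <= t <= h &
    f (a + h *: w + h *: v) - f (a + h *: v) - (f (a + h *: w) - f a)
    = h ^+ 2 * 'D_v ('D_w f) (a + s *: w + t *: v)].
  apply: second_difference => // s' t' sI' tI'.
  have [Ay _] := Ph t' s' tI' sI'; rewrite addrAC in Ay.
  by split; apply: diff_derivable; [exact: df|have [+ _] := d2f w; exact].
have E : 'D_w ('D_v f) (a + s *: v + t *: w) = 'D_v ('D_w f) (a + t' *: v + s' *: w).
  apply: (@mulfI _ (h ^+ 2)); first by rewrite expf_neq0// gt_eqF.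
  have swap (b c d : R) : b - c - (d - f a) = b - d - (c - f a) by ring.
  rewrite (addrAC a (t' *: v)); apply: etrans (esym E1) (etrans _ E2).
  by rewrite swap (addrAC a (h *: w)).
have [_ [/= b1 _]] := Ph s t sI tI; have [_ [_ /= b2]] := Ph t' s' tI' sI'.
rewrite addr0; rewrite -E in b2.
by apply: ltW; apply: norm_sub_lt_mid b1 b2.
Qed.

(** * Smooth maps, the chain rule along a graph, and the algebra of skew closed forms *)

Lemma smooth_on_differentiable (R : realType) (V W : normedModType R)
    (A : set V) (f : V -> W) (a : V) :
  smooth_on A f -> A a -> differentiable f a.
Proof. by move=> /(_ 1)[+ _]; exact. Qed.

Lemma smooth_on_derive (R : realType) (V W : normedModType R)
    (A : set V) (f : V -> W) (v : V) :
  smooth_on A f -> smooth_on A ('D_v f).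
Proof. by move=> sf k; have [_] := sf k.+1; exact. Qed.

Lemma differentiable_component (R : realType) (V : normedModType R) (n : nat)
    (f : V -> 'cV[R]_n) (mu : 'I_n) (a : V) :
  differentiable f a -> differentiable (component f mu) a.
Proof. by move=> df; apply: differentiable_comp df (differentiable_coord _ _ _). Qed.

Lemma derive_component (R : realType) (V : normedModType R) (n : nat)
    (f : V -> 'cV[R]_n) (mu : 'I_n) (a v : V) :
  differentiable f a -> 'D_v (component f mu) a = component ('D_v f) mu a.
Proof.
by move=> df; rewrite /component derive_mx ?mxE//; exact: diff_derivable.
Qed.

(** Induction on the order for all [f] at once, because the inductive step passes to ['D_v f], whose
    components are the derivatives of those of [f]. *)
Lemma smooth_component (R : realType) (V : normedModType R) (n : nat)
    (f : V -> 'cV[R]_n) (mu : 'I_n) :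
  smooth_on setT f -> smooth_on setT (component f mu).
Proof.
move=> sf k; elim: k f sf => [|k IH] f sf /=.
  move=> a _; apply: differentiable_continuous; apply: differentiable_component.
  exact: smooth_on_differentiable sf I.
have df a : differentiable f a by exact: smooth_on_differentiable sf I.
split=> [a _|v]; first exact: differentiable_component.
rewrite (_ : 'D_v (component f mu) = component ('D_v f) mu).
  exact/IH/smooth_on_derive.
by apply/funext => a; exact: derive_component.
Qed.

Lemma is_derive_graph (R : realType) (n : nat) (g : 'cV[R]_n * (R * R) -> R)
    (z : R * R -> 'cV[R]_n) (p e : R * R) :
  differentiable z p -> differentiable g (z p, p) ->
  is_derive p e (fun q => g (z q, q))
    ('D_(0, e) g (z p, p)
     + \sum_tau pdz tau g (z p, p) * 'D_e (component z tau) p).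
Proof.
move=> dz dg.
have dzid : differentiable (fun q => (z q, q)) p by exact: differentiable_pair.
have dgz : differentiable (g \o (fun q => (z q, q))) p.
  exact: differentiable_comp.
split; first exact: diff_derivable.
have dpair : 'd (fun q => (z q, q)) p e = ('D_e z p, e).
  by rewrite diff_pair//= diff_val -deriveE.
have dcomp : 'd (g \o (fun q => (z q, q))) p e = 'd g (z p, p) ('D_e z p, e).
  by rewrite diff_comp//= dpair.
(* The tangent to the graph splits into the explicit direction [(0, e)] and a combination of the
   basis vectors of the [z]-space. *)
have Ee : ('D_e z p, e) = (0, e) + \sum_tau 'D_e (component z tau) p *:
    ((delta_mx tau 0, (0, 0)) : 'cV[R]_n * (R * R)).
  have sum_pair (I : finType) (f : I -> 'cV[R]_n * (R * R)) :
      \sum_i f i = (\sum_i (f i).1, \sum_i (f i).2).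
    by elim/big_rec3 : _ => // i x y w _ ->.
  rewrite sum_pair; apply: injective_projections => /=; last first.
    by rewrite big1 ?addr0// => tau _; rewrite scaler0.
  rewrite add0r.
  apply/colP => i; rewrite summxE (bigD1 i)//= big1 ?addr0.
    by rewrite !mxE !eqxx mulr1 derive_component.
  by move=> j ji; rewrite !mxE eq_sym (negbTE ji) mulr0.
transitivity ('d (g \o (fun q => (z q, q))) p e); first exact: deriveE.
rewrite dcomp Ee.
rewrite linearD linear_sum; congr (_ + _); first by rewrite deriveE.
apply: eq_bigr => tau _.
by rewrite linearZ /= [pdz _ _ _](deriveE _ dg) [LHS]mulrC.
Qed.

(* Index c tau mu nu stands for d M_(mu nu) / d z^tau, and s tau mu for the
   derivative in z^tau of the explicit derivative of F_mu. *)
Lemma skew_form_sum (R : comRingType) (n : nat) (m s : 'I_n -> 'I_n -> R)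
    (c : 'I_n -> 'I_n -> 'I_n -> R) (u v du dv dz : 'I_n -> R) :
  (forall mu nu, m mu nu = - m nu mu) ->
  (forall tau mu nu, c tau mu nu = c nu mu tau - c mu nu tau) ->
  \sum_mu \sum_nu
    ((s mu nu - s nu mu + \sum_tau c tau mu nu * dz tau) * u nu * v mu
     + m mu nu * du nu * v mu + m mu nu * u nu * dv mu)
  = \sum_mu v mu * (\sum_nu m mu nu * du nu
       + \sum_nu \sum_tau c tau mu nu * dz nu * u tau - \sum_tau s tau mu * u tau)
  - \sum_mu u mu * (\sum_nu m mu nu * dv nu
       + \sum_nu \sum_tau c tau mu nu * dz nu * v tau - \sum_tau s tau mu * v tau).
Proof.
move=> mskew ccyc.
(* Renaming indices makes [y nu] a common index, so that both pairings can be compared term by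
   term. *)
have expand (x y dy : 'I_n -> R) :
  \sum_mu x mu * (\sum_nu m mu nu * dy nu
       + \sum_nu \sum_tau c tau mu nu * dz nu * y tau - \sum_tau s tau mu * y tau)
  = \sum_mu \sum_nu x mu * (m mu nu * dy nu
       + (\sum_tau c nu mu tau * dz tau) * y nu - s nu mu * y nu).
  apply: eq_bigr => mu _; rewrite -mulr_sumr; congr (_ * _).
  rewrite [X in _ + X - _]exchange_big/= -big_split/= -sumrB.
  by apply: eq_bigr => nu _; rewrite mulr_suml.
(* Exchanging the sums in the second pairing gives both the factor [u nu * v mu]; closedness then
   merges the two [c]-sums, and skewness turns the [dv] terms into those of the product rule. *)
rewrite !expand [X in _ - X]exchange_big/= -sumrB; apply: eq_bigr => mu _.
rewrite -sumrB; apply: eq_bigr => nu _.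
under eq_bigr do rewrite ccyc mulrBl.
by rewrite sumrB (mskew nu mu); ring.
Qed.

(** * The Birkhoff matrix and the derivative of its two-form *)

Lemma birkhoff_entryE (R : realType) (n : nat)
    (F : 'cV[R]_n * (R * R) -> 'cV[R]_n) (mu nu : 'I_n) :
  birkhoff_entry F mu nu = pdz mu (component F nu) - pdz nu (component F mu).
Proof. by apply/funext => y; rewrite /birkhoff_entry mxE. Qed.

Lemma differentiable_derive_component (R : realType) (V : normedModType R) (n : nat)
    (F : V -> 'cV[R]_n) (mu : 'I_n) (v y : V) :
  smooth_on setT F -> differentiable ('D_v (component F mu)) y.
Proof.
move=> sF.
exact: smooth_on_differentiable (smooth_on_derive v (smooth_component mu sF)) I.
Qed.

Lemma smooth_derive_symmetric (R : realType) (V : normedModType R)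
    (f : V -> R) (a v w : V) :
  smooth_on setT f -> 'D_w ('D_v f) a = 'D_v ('D_w f) a.
Proof. by move=> sf; apply: (@derive_symmetric R V setT) => //; exact: openT. Qed.

Lemma differentiable_birkhoff_entry (R : realType) (n : nat)
    (F : 'cV[R]_n * (R * R) -> 'cV[R]_n) (mu nu : 'I_n) y :
  smooth_on setT F -> differentiable (birkhoff_entry F mu nu) y.
Proof.
move=> sF; rewrite birkhoff_entryE.
by apply: differentiableB; exact: differentiable_derive_component.
Qed.

(** Second derivatives commute, so differentiating the matrix of [F] gives the matrix of the
    derivative of [F]. Directions in [z] serve for closedness, directions [(0, e)] for the explicit
    derivative of the matrix. *)
Lemma derive_birkhoff_entry (R : realType) (n : nat)
    (F : 'cV[R]_n * (R * R) -> 'cV[R]_n) (mu nu : 'I_n) y v :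
  smooth_on setT F ->
  'D_v (birkhoff_entry F mu nu) y
  = pdz mu ('D_v (component F nu)) y - pdz nu ('D_v (component F mu)) y.
Proof.
move=> sF; rewrite birkhoff_entryE.
have S i j : 'D_v (pdz i (component F j)) y = pdz i ('D_v (component F j)) y.
  exact: (smooth_derive_symmetric y (delta_mx i 0, (0, 0)) v (smooth_component j sF)).
have D i j : derivable (pdz i (component F j)) y v.
  by apply: diff_derivable; exact: differentiable_derive_component.
apply: etrans (deriveB (D mu nu) (D nu mu)) _.
by rewrite (S mu nu) (S nu mu).
Qed.

Lemma birkhoff_mx_skew (R : realType) (n : nat)
    (F : 'cV[R]_n * (R * R) -> 'cV[R]_n) y (mu nu : 'I_n) :
  birkhoff_mx F y mu nu = - birkhoff_mx F y nu mu.
Proof. by rewrite !mxE opprB. Qed.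

(* The two-form with matrix M is exact, hence closed. *)
Lemma birkhoff_closed (R : realType) (n : nat)
    (F : 'cV[R]_n * (R * R) -> 'cV[R]_n) y (tau mu nu : 'I_n) :
  smooth_on setT F ->
  pdz tau (birkhoff_entry F mu nu) y
  = pdz nu (birkhoff_entry F mu tau) y - pdz mu (birkhoff_entry F nu tau) y.
Proof.
move=> sF.
have E i j k : pdz i (birkhoff_entry F j k) y
    = pdz j (pdz i (component F k)) y - pdz k (pdz i (component F j)) y.
  exact: derive_birkhoff_entry.
have S i j k : pdz i (pdz j (component F k)) y = pdz j (pdz i (component F k)) y.
  by apply: smooth_derive_symmetric; exact: smooth_component.
have telescope (a b c : R) : a - b = (c - b) - (c - a) by ring.
(* Once the derivatives are put in a common order, the two terms in the component [tau] of [F]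
   cancel. *)
rewrite !E (S mu tau nu) (S nu tau mu) (S nu mu tau).
exact: telescope.
Qed.

(* The F-part of the variational equations when e is the t-direction (0, 1);
   applied to G with e = (1, 0), the G-part. *)
Definition linear_residual (R : realType) (n : nat)
    (F : 'cV[R]_n * (R * R) -> 'cV[R]_n) (z U : R * R -> 'cV[R]_n)
    (p e : R * R) (mu : 'I_n) : R :=
  \sum_nu birkhoff_mx F (z p, p) mu nu * 'D_e (component U nu) p
  + \sum_nu \sum_tau pdz tau (birkhoff_entry F mu nu) (z p, p)
      * 'D_e (component z nu) p * U p tau 0
  - \sum_tau pdz tau ('D_(0, e) (component F mu)) (z p, p) * U p tau 0.

(** The product rule on the double sum, with the chain rule for the entries, gives the left side of
    [skew_form_sum]; there [s] is the [z]-derivative of the explicit derivative of [F] along [e]. *)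
Lemma is_derive_pulled_form (R : realType) (n : nat)
    (F : 'cV[R]_n * (R * R) -> 'cV[R]_n) (z U V : R * R -> 'cV[R]_n)
    (p e : R * R) :
  smooth_on setT F -> differentiable z p -> differentiable U p ->
  differentiable V p ->
  is_derive p e (pulled_form F z U V)
    (\sum_mu V p mu 0 * linear_residual F z U p e mu
     - \sum_mu U p mu 0 * linear_residual F z V p e mu).
Proof.
move=> sF dz dU dV.
have -> : pulled_form F z U V = \sum_mu \sum_nu
    ((fun q => birkhoff_entry F mu nu (z q, q)) * component U nu * component V mu).
  apply/funext => q; rewrite /pulled_form /inner fct_sumE; apply: eq_bigr => mu _.
  rewrite mxE mulr_suml fct_sumE; apply: eq_bigr => nu _.
  by rewrite /birkhoff_entry.
have dc (f : R * R -> 'cV[R]_n) nu : differentiable f p ->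
    is_derive p e (component f nu) ('D_e (component f nu) p).
  by move=> df; apply/derivableP/diff_derivable/differentiable_component.
have dM mu nu := is_derive_graph e dz
  (differentiable_birkhoff_entry mu nu (z p, p) sF).
have dsum := is_derive_sum (fun mu => is_derive_sum (fun nu =>
  is_deriveM (is_deriveM (dM mu nu) (dc U nu dU)) (dc V mu dV))).
apply: (is_derive_eq dsum).
rewrite /linear_residual -skew_form_sum; last 2 first.
- by move=> mu nu; exact: birkhoff_mx_skew.
- by move=> tau mu nu; exact: birkhoff_closed.
apply: eq_bigr => mu _; apply: eq_bigr => nu _.
rewrite derive_birkhoff_entry//.
have leibniz (m s u v du dv : R) :
  m * u * dv + v * (m * du + u * s) = s * u * v + m * du * v + m * u * dv by ring.
exact: leibniz.
Qed.

(** * The variational equations and the conservation law *)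

Lemma pdz_birkhoff_rhs (R : realType) (n : nat)
    (F G : 'cV[R]_n * (R * R) -> 'cV[R]_n) (B : 'cV[R]_n * (R * R) -> R)
    (mu tau : 'I_n) y :
  smooth_on setT F -> smooth_on setT G -> smooth_on setT B ->
  pdz tau (birkhoff_rhs F G B mu) y
  = pdz tau (pdz mu B) y + pdz tau (pdt (component F mu)) y
    + pdz tau (pdx (component G mu)) y.
Proof.
move=> sF sG sB; set v := (delta_mx tau 0, (0, 0)) : 'cV[R]_n * (R * R).
have dB : derivable (pdz mu B) y v.
  by apply: diff_derivable; exact: smooth_on_differentiable (smooth_on_derive _ sB) I.
have dF : derivable (pdt (component F mu)) y v.
  by apply: diff_derivable; exact: differentiable_derive_component.
have dG : derivable (pdx (component G mu)) y v.
  by apply: diff_derivable; exact: differentiable_derive_component.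
apply: etrans (deriveD (derivableD dB dF) dG) _.
by congr (_ + _); exact: deriveD.
Qed.

(** The explicit [t]-derivative of [F] and [x]-derivative of [G] on the right of the equations are
    absorbed by the two residuals, which leaves only the Hessian of [B]. *)
Lemma variational_residual (R : realType) (n : nat)
    (F G : 'cV[R]_n * (R * R) -> 'cV[R]_n) (B : 'cV[R]_n * (R * R) -> R)
    (Omega : set (R * R)) (z U : R * R -> 'cV[R]_n) (p : R * R) (mu : 'I_n) :
  smooth_on setT F -> smooth_on setT G -> smooth_on setT B ->
  variational_eqs F G B Omega z U -> Omega p ->
  linear_residual F z U p (0, 1) mu + linear_residual G z U p (1, 0) mu
  = \sum_tau pdz tau (pdz mu B) (z p, p) * U p tau 0.
Proof.
move=> sF sG sB Usol Op; have := Usol p Op mu.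
under [RHS]eq_bigr do rewrite pdz_birkhoff_rhs// !mulrDl.
rewrite !big_split/=.
under [X in _ + X = _]eq_bigr do (under eq_bigr do rewrite mulrDl; rewrite big_split).
rewrite big_split/=.
have rearrange (a b c d k l m : R) :
  a + b + (c + d) = k + l + m -> a + c - l + (b + d - m) = k.
  by move=> E; rewrite addrACA (addrACA a) E; ring.
exact: rearrange.
Qed.

Unset Implicit Arguments.

Theorem mainTheorem1 (R : realType) (n : nat) (n_ge2 : (2 <= n)%N)
  (F G : 'cV[R]_n * (R * R) -> 'cV[R]_n) (B : 'cV[R]_n * (R * R) -> R)
  (F_smooth : smooth_on setT F) (G_smooth : smooth_on setT G)
  (B_smooth : smooth_on setT B)
  (Omega : set (R * R)) (Omega_open : open Omega)
  (z : R * R -> 'cV[R]_n) (z_smooth : smooth_on Omega z)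
  (z_sol : birkhoff_eqs F G B Omega z)
  (U V : R * R -> 'cV[R]_n)
  (U_smooth : smooth_on Omega U) (V_smooth : smooth_on Omega V)
  (U_sol : variational_eqs F G B Omega z U)
  (V_sol : variational_eqs F G B Omega z V) :
  let omega := pulled_form F z U V in
  let kappa := pulled_form G z U V in
  forall p, Omega p ->
    [/\ derivable omega p (0, 1), derivable kappa p (1, 0)
      & ddt omega p + ddx kappa p = 0].
Proof.
move=> omega kappa p Op.
have dz := smooth_on_differentiable z_smooth Op.
have dU := smooth_on_differentiable U_smooth Op.
have dV := smooth_on_differentiable V_smooth Op.
have [domega omegaE] := is_derive_pulled_form (0, 1) F_smooth dz dU dV.
have [dkappa kappaE] := is_derive_pulled_form (1, 0) G_smooth dz dU dV.
split; [exact: domega|exact: dkappa|].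
apply: etrans (f_equal2 +%R omegaE kappaE) _.
(* Collects the [F]- and [G]-residuals of [U], paired with [V], and those of [V], paired with
   [U]. *)
rewrite addrACA -opprD -!big_split/=.
have pairing (X Y : R * R -> 'cV[R]_n) : variational_eqs F G B Omega z X ->
    \sum_mu (Y p mu 0 * linear_residual F z X p (0, 1) mu
             + Y p mu 0 * linear_residual G z X p (1, 0) mu)
    = \sum_mu \sum_tau pdz tau (pdz mu B) (z p, p) * (Y p mu 0 * X p tau 0).
  move=> Xsol; apply: eq_bigr => mu _.
  rewrite -mulrDr (variational_residual _ F_smooth G_smooth B_smooth Xsol Op).
  by rewrite mulr_sumr; apply: eq_bigr => tau _; rewrite mulrCA.
(* Exchanging the sums transposes the second Hessian pairing, so the terms match by symmetry of the
   second derivatives of [B]. *)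
rewrite !pairing// [X in _ - X]exchange_big/=; apply/eqP; rewrite subr_eq0; apply/eqP.
apply: eq_bigr => mu _; apply: eq_bigr => tau _.
apply: f_equal2 (mulrC _ _); exact: smooth_derive_symmetric.
Qed.
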